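(* Let $F$ be a nondegenerate form (defining the quadric $v=F(z,z)$ of codimension $k$) with $k\le 3$. Then $F$ is T-nondegenerate, hence $\mathfrak g_3=0$.
   Context: $F=(F_1,\dots,F_k)$ is a $\mathbb C^k$-valued Hermitian form on $\mathbb C^m$: $F_j(a,b)=\langle A_ja,b\rangle$, $\langle a,b\rangle=\sum_l a_l\bar b_l$, with $A_1,\dots,A_k$ Hermitian $m\times m$ matrices. $F$ is nondegenerate if (a) $A_1,\dots,A_k$ are linearly independent and (b) $F(z,\zeta)=0$ for all $z\in\mathbb C^m$ implies $\zeta=0$. For a set $S\subset\mathbb C^m$ put $S^F=\{x\in\mathbb C^m:\ F(x,y)=0\ \ \forall y\in S\}$. For $a\in\mathbb C^m$ put $T(a)=\{y\in\mathbb C^m:\ \exists x\in\mathbb C^m,\ F(x,a)+F(a,y)=0\}$. A property holds for generic $a\in\mathbb C^m$ if it holds for all $a$ in some open dense subset of $\mathbb C^m$. A nondegenerate form $F$ is T-nondegenerate if $T(a)^F=0$ for generic $a\in\mathbb C^m$. With coordinates $z\in\mathbb C^m$, $w=u+iv\in\mathbb C^k$, $\mathfrak g=\sum_{p\ge-2}\mathfrak g_p$ is the graded Lie algebra of infinitesimal CR automorphisms of the quadric $v=F(z,z)$. Giving $z_j,w_j,\partial/\partial z_j,\partial/\partial w_j$ weights $1,2,-1,-2$, $\mathfrak g_p$ is the subspace of weighted homogeneous elements of degree $p$, i.e. the space of vector fields $f\frac{\partial}{\partial z}+g\frac{\partial}{\partial w}$ with $f$ ($\mathbb C^m$-valued)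 and $g$ ($\mathbb C^k$-valued) weighted homogeneous holomorphic polynomials in $(z,w)$ of weighted degrees $p+1$ and $p+2$ such that $\operatorname{Im}(g-2iF(f,z))|_{w=u+iF(z,z)}=0$ for all $z\in\mathbb C^m$, $u\in\mathbb R^k$. In particular, $\mathfrak g_3$ is the case $p=3$. *)

(* Defs.v *)
From HB Require Import structures.
From mathcomp Require Import all_boot all_order all_algebra.
From mathcomp Require Import boolp classical_sets reals topology normedtype.
From mathcomp Require Import complex sesquilinear.
From mathcomp Require Import -(notations) mpoly.

Set Implicit Arguments.
Unset Strict Implicit.
Unset Printing Implicit Defensive.

Import Order.TTheory GRing.Theory Num.Theory.
Import numFieldNormedType.Exports.

Local Open Scope classical_set_scope.
Local Open Scope ring_scope.
Local Open Scope complex_scope.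

Section HermitianForm.
Context {R : realType} {m k : nat}.
Local Notation C := R[i].
Variable A : 'I_k -> 'M[C]_m.

Definition hermdot (a b : 'cV[C]_m) : C := \sum_(l < m) a l 0 * (b l 0)^*%R.

Definition hform (a b : 'cV[C]_m) : 'cV[C]_k := \col_j hermdot (A j *m a) b.

Definition nondegenerate_form : Prop :=
  free [seq A j | j : 'I_k] /\
  (forall zeta, (forall z, hform z zeta = 0) -> zeta = 0).

Definition orthF (S : set 'cV[C]_m) : set 'cV[C]_m :=
  [set x | forall y, S y -> hform x y = 0].

Definition Tset (a : 'cV[C]_m) : set 'cV[C]_m :=
  [set y | exists x, hform x a + hform a y = 0].

(* MathComp-Analysis attaches the norm topology to the alias [C^o] of the
   field [C]; as types, ['cV[C^o]_m] and ['cV[C]_m] are the same. *)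
Definition generic (P : 'cV[C]_m -> Prop) : Prop :=
  exists U : set 'cV[C^o]_m, [/\ open U, dense U & forall a, U a -> P a].

Definition T_nondegenerate_form : Prop :=
  nondegenerate_form /\ generic (fun a => orthF (Tset a) = [set 0]).

(* Polynomials in (z, w): the variables of index [lshift k _] are the z's and
   those of index [rshift m _] are the w's. *)
Local Notation poly_zw := (mpoly (m + k) C).

Definition wdeg (mu : multinom (m + k)) : nat :=
  (\sum_(i < m) mu (lshift k i) + 2 * \sum_(j < k) mu (rshift m j))%N.

(* The degree is an integer because components of weighted degree p + 1 occur
   with p = -2; in negative degree only 0 is homogeneous. *)
Definition whomog (d : int) (p : poly_zw) : Prop :=
  forall mu, mu \in msupp p -> (wdeg mu)%:Z = d.

Definition eval_zw {n} (z : 'cV[C]_m) (w : 'cV[C]_k) (f : 'cV[poly_zw]_n) :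
    'cV[C]_n :=
  map_mx (meval (fun i => col_mx z w i 0)) f.

(* The pair (f, g) stands for the vector field f d/dz + g d/dw. *)
Definition gcomp (p : int) : set ('cV[poly_zw]_m * 'cV[poly_zw]_k) :=
  [set fg : 'cV[poly_zw]_m * 'cV[poly_zw]_k |
    [/\ forall i, whomog (p + 1) (fg.1 i 0),
        forall j, whomog (p + 2) (fg.2 j 0) &
        forall (z : 'cV[C]_m) (u : 'cV[R]_k),
          let w := map_mx (real_complex R) u + 'i *: hform z z in
          let h := eval_zw z w fg.2
                   - (2 * 'i) *: hform (eval_zw z w fg.1) z in
          map_mx (@complex.Im R) h = 0]].

End HermitianForm.

(* Main.v *)
Require Import Defs.
From mathcomp Require Import all_boot all_order all_algebra.
From mathcomp Require Import boolp classical_sets reals topology normedtype.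
From mathcomp Require Import complex sesquilinear ring.
From mathcomp Require Import -(notations) mpoly.

Set Implicit Arguments.
Unset Strict Implicit.
Unset Printing Implicit Defensive.

Import Order.TTheory GRing.Theory Num.Theory.
Import numFieldNormedType.Exports.

Local Open Scope ring_scope.

(** Write [A_c = \sum_j c_j A_j] ([pencil]) and let [M(a)] ([evmx]) be the matrix
with columns [A_j a], so that [M(a) c = A_c a] and [F(x, a) = M(a)^* x]; the
form [F] itself is [form].

T-nondegeneracy.  If [M(a)] has rank [k] at one point, then it does so off the
zero set of a minor, and there [F(., a)] is onto, [T(a)] is everything and
[T(a)^F = 0] by nondegeneracy.  Otherwise the [A_j a] are dependent for every
[a].  A matrix [B] such that [B b] and [B^* b] are dependent for all [b] has
[B^*] proportional to [B] ([adj_dep]); applied to [A_1 + i A_2] this forces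
generic rank at least 2, so that [k = 3] and the generic rank is exactly 2.
Let [d] span the kernel of [M(a)] and put [v = A_d^* a].  Then [T(a)] contains
the orthogonal of [v], hence [x] in [T(a)^F] satisfies [A_c x = l(c) v] for
all [c].  As all [M(b)] have rank at most 2, all 3 x 3 minors of
[b |-> M(b)] vanish identically; expanding them around [b = a] and in the
direction of [x] shows that [x] is orthogonal to the ranges of [A_d] and of
[A_d^*].  By [adj_dep] these two fill a plane generically, a plane that
contains all [A_c b]; so [x] is orthogonal to every [A_c b], and [x = 0]
([T_orth_hyperplane]).

Vanishing of [g_3].  Polarising the tangency condition gives an identity in
independent [z], [y], [w] ([segre_f]).  Its part at [y = 0] expresses [g]
through [phi(w) = f(0, w)], a quadratic map, and its part that is odd in [z]
gives [F(phi(F(y, z)), z) = 0].  Differentiating at [z = y = a] in a direction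
of [T(a)] shows that [phi(F(a, a))] lies in [T(a)^F = 0], whence
[phi(F(z, y)) = 0] for all [z], [y].  The vectors [F(a, y)] fill a hyperplane
at least, so a component of [phi] that is not zero is a product of two linear
forms; one of them would kill all values of [F], against the linear
independence of the [A_j].  So [phi = 0], and then the same identities give
[g = 0] and [f = 0].

Polynomial maps enter only through their restrictions to polynomial curves
([polyfun], [polycurve]): a polynomial in one variable with infinitely many
zeros vanishes.  This one fact yields polarisation (a function of [t] that
vanishes at real [t] vanishes at [t = i]), limits at [t = 0], and the density
of the set where a minor does not vanish. *)

(** * The Hermitian product and pencils of Hermitian matrices *)

Section Hermitian.
Variable C : numClosedFieldType.
Implicit Types x t : C.

Definition cmx p q (M : 'M[C]_(p, q)) : 'M[C]_(p, q) := map_mx Num.conj M.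
Definition adjmx p q (M : 'M[C]_(p, q)) : 'M[C]_(q, p) := cmx M^T.

Lemma cmxK p q : involutive (@cmx p q).
Proof. by move=> M; apply/matrixP=> i j; rewrite !mxE conjCK. Qed.

Lemma cmx0 p q : cmx (0 : 'M_(p, q)) = 0.
Proof. by apply/matrixP=> i j; rewrite !mxE conjC0. Qed.

Lemma cmxD p q (M N : 'M[C]_(p, q)) : cmx (M + N) = cmx M + cmx N.
Proof. by apply/matrixP=> i j; rewrite !mxE rmorphD. Qed.

Lemma cmxZ p q x (M : 'M[C]_(p, q)) : cmx (x *: M) = x^* *: cmx M.
Proof. by apply/matrixP=> i j; rewrite !mxE rmorphM. Qed.

Lemma cmxB p q (M N : 'M[C]_(p, q)) : cmx (M - N) = cmx M - cmx N.
Proof. by apply/matrixP=> i j; rewrite !mxE rmorphB. Qed.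

Section Dot.
Variable m : nat.
Implicit Types a b u v w r : 'cV[C]_m.

Definition dot a b : C := \sum_(l < m) a l 0 * (b l 0)^*.

Lemma dotDl a b r : dot (a + b) r = dot a r + dot b r.
Proof. by rewrite -big_split; apply: eq_bigr => l _; rewrite mxE mulrDl. Qed.

Lemma dotZl x a r : dot (x *: a) r = x * dot a r.
Proof. by rewrite mulr_sumr; apply: eq_bigr => l _; rewrite mxE mulrA. Qed.

Lemma dotC a b : dot b a = (dot a b)^*.
Proof.
by rewrite rmorph_sum; apply: eq_bigr => l _; rewrite rmorphM /= conjCK mulrC.
Qed.

Lemma dotDr a b r : dot r (a + b) = dot r a + dot r b.
Proof. by rewrite dotC dotDl rmorphD /= -!dotC. Qed.

Lemma dotZr x a r : dot r (x *: a) = x^* * dot r a.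
Proof. by rewrite dotC dotZl rmorphM /= -!dotC. Qed.

Lemma dot0l r : dot 0 r = 0.
Proof. by rewrite -(scale0r 0) dotZl mul0r. Qed.

Lemma dot0r r : dot r 0 = 0.
Proof. by rewrite dotC dot0l rmorph0. Qed.

Lemma dotNl a r : dot (- a) r = - dot a r.
Proof. by rewrite -scaleN1r dotZl mulN1r. Qed.

Lemma dot_suml I (s : seq I) (P : pred I) (f : I -> 'cV[C]_m) r :
  dot (\sum_(i <- s | P i) f i) r = \sum_(i <- s | P i) dot (f i) r.
Proof.
elim/big_rec2: _ => [|i y1 y2 _ IH]; first exact: dot0l.
by rewrite dotDl -IH.
Qed.

Lemma dot_self_eq0 a : dot a a = 0 -> a = 0.
Proof.
move=> /eqP; rewrite psumr_eq0 => [/allP a0|l _]; last exact: mul_conjC_ge0.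
apply/matrixP=> l j; rewrite ord1 mxE; apply/eqP; rewrite -mul_conjC_eq0.
by apply: (a0 l); rewrite mem_index_enum.
Qed.

Lemma dot_eq0l a : (forall r, dot a r = 0) -> a = 0.
Proof. by move=> /(_ a)/dot_self_eq0. Qed.

(** The orthogonal projection of [u] away from [v] is orthogonal to [v], hence by
hypothesis to [u], hence to itself. *)
Lemma dot_orth_line u v :
  (forall y, dot v y = 0 -> dot u y = 0) -> exists x, u = x *: v.
Proof.
move=> uv; have [v0|v0] := eqVneq v 0.
  by exists 0; rewrite scale0r; apply: dot_eq0l => r; apply: uv; rewrite v0 dot0l.
have vv0 : dot v v != 0 by apply: contra_neq v0; exact: dot_self_eq0.
exists (dot u v / dot v v); apply/subr0_eq; set y := (X in X = 0).
have vy : dot v y = 0.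
  by rewrite dotC dotDl dotNl dotZl divfK // subrr rmorph0.
by apply: dot_self_eq0; rewrite {1}/y dotDl dotNl dotZl vy (uv _ vy) mulr0 subr0.
Qed.

(** Linear functionals on column vectors are written [dot _ r], so that a minor of
a family of vectors is indexed by vectors [r1], [r2]. *)
Definition minor2 r1 r2 u v : C := dot u r1 * dot v r2 - dot u r2 * dot v r1.

(** The 3 x 3 determinant, expanded along its third functional: in the
applications [r3] kills some of the vectors and the expansion collapses. *)
Definition minor3 r1 r2 r3 u v w : C :=
  dot w r3 * minor2 r1 r2 u v - dot v r3 * minor2 r1 r2 u w
    + dot u r3 * minor2 r1 r2 v w.

Lemma minor2_eq0_line u v : u != 0 ->
  (forall r1 r2, minor2 r1 r2 u v = 0) -> exists x, v = x *: u.
Proof.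
move=> u0 uv; apply: dot_orth_line => y uy.
have uu0 : dot u u != 0 by apply: contra_neq u0; exact: dot_self_eq0.
apply: (mulfI uu0); rewrite mulr0 -(uv u y) /minor2 uy; ring.
Qed.

End Dot.

Lemma dot_adj p q (M : 'M[C]_(p, q)) a b : dot (M *m a) b = dot a (adjmx M *m b).
Proof.
transitivity (\sum_(i < p) \sum_(j < q) M i j * a j 0 * (b i 0)^*).
  by apply: eq_bigr => i _; rewrite mxE mulr_suml.
rewrite exchange_big; apply: eq_bigr => j _ /=.
rewrite mxE rmorph_sum mulr_sumr; apply: eq_bigr => i _ /=.
by rewrite !mxE rmorphM /= conjCK mulrA (mulrC (a j 0)).
Qed.

Lemma adjmxK p q (M : 'M[C]_(p, q)) : adjmx (adjmx M) = M.
Proof. by apply/matrixP=> i j; rewrite !mxE conjCK. Qed.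

Lemma dot_adjV p q (M : 'M[C]_(p, q)) a b : dot a (M *m b) = dot (adjmx M *m a) b.
Proof. by rewrite dot_adj adjmxK. Qed.

Lemma adjmxM p q n (M : 'M[C]_(p, q)) (N : 'M_(q, n)) :
  adjmx (M *m N) = adjmx N *m adjmx M.
Proof. by rewrite /adjmx trmx_mul /cmx map_mxM. Qed.

Lemma adjmx0 p q : adjmx (0 : 'M[C]_(p, q)) = 0.
Proof. by rewrite /adjmx trmx0 cmx0. Qed.

(** Over the complex numbers the quadratic form of a matrix determines it: compare
the cross terms at [b + c] and at [b + i c]. *)
Lemma dot_quad_eq0 m (B : 'M[C]_m) : (forall b, dot (B *m b) b = 0) -> B = 0.
Proof.
move=> B0.
have sym b c : dot (B *m b) c + dot (B *m c) b = 0.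
  have := B0 (b + c); rewrite mulmxDr !dotDl !dotDr !B0 => <-; ring.
have Bbc b c : dot (B *m b) c = 0.
  have := sym b ('i *: c); rewrite -scalemxAr dotZl dotZr conjCi => h.
  have {}h : 'i * (dot (B *m c) b - dot (B *m b) c) = 0 by rewrite -h; ring.
  move/eqP: h; rewrite mulf_eq0 (negPf (neq0Ci _)) subr_eq0 => /eqP h.
  have := sym b c; rewrite h -mulr2n => /eqP; rewrite mulrn_eq0 => /eqP //.
apply/matrixP=> i j; rewrite [RHS]mxE.
have /matrixP/(_ i 0) : B *m delta_mx j (0 : 'I_1) = 0.
  by apply: dot_eq0l => r; exact: Bbc.
by rewrite -colE !mxE.
Qed.

(** Choose [b0] with [<B b0, b0>] nonzero; then [B^* b0 = x B b0] and, comparing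
[<B^* b0, b0>] with the conjugate of [<B b0, b0>], [|x| = 1].  The matrix
[G = B^* - x B] kills [b0], so polarising the dependence of [B b] and [G b] at
[b0] puts the range of [G] on the line of [B b0].  But [G^* b0] vanishes too
because [|x| = 1], so this range is orthogonal to [b0], and [G = 0]. *)
Lemma adj_dep m (B : 'M[C]_m) :
    (forall b r1 r2, minor2 r1 r2 (B *m b) (adjmx B *m b) = 0) ->
  exists x, adjmx B = x *: B.
Proof.
move=> dep; have [->|B0] := eqVneq B 0.
  by exists 0; rewrite scale0r adjmx0.
have [b0 Bb0] : exists b0, dot (B *m b0) b0 != 0.
  apply: contrapT => noB; move/eqP: B0; apply; apply: dot_quad_eq0 => b.
  by apply: contrapT => Bb; apply: noB; exists b; apply/eqP.
have Bb00 : B *m b0 != 0 by apply: contra_neq Bb0 => ->; rewrite dot0l.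
have [x xb0] := minor2_eq0_line Bb00 (dep b0).
have xb : (dot (B *m b0) b0)^* = x * dot (B *m b0) b0.
  by rewrite -dotZl -xb0 -dotC dot_adjV.
have xx1 : x^* * x = 1.
  by apply: (mulIf Bb0); rewrite mul1r -[RHS]conjCK xb rmorphM /= xb mulrA.
exists x; pose G := adjmx B - x *: B.
have Gb0 : G *m b0 = 0 by rewrite mulmxBl -scalemxAl xb0 subrr.
have G0 (b : 'cV_m) : G *m b = 0.
  have [y Gb] : exists y, G *m b = y *: (B *m b0).
    apply: minor2_eq0_line => // r1 r2; have := dep (b0 + b) r1 r2.
    have dG (c : 'cV_m) : adjmx B *m c = G *m c + x *: (B *m c).
      by rewrite mulmxBl -scalemxAl subrK.
    have dp c : minor2 r1 r2 (B *m c) (G *m c) = 0.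
      rewrite -[RHS](dep c r1 r2) dG /minor2 !dotDl !dotZl; ring.
    move: (dp (b0 + b)) (dp b); rewrite !mulmxDr Gb0 add0r /minor2 !dotDl => h1 h2 _.
    by rewrite -[RHS](subrr (0 : C)) -{1}h1 -{1}h2; ring.
  rewrite Gb; suff -> : y = 0 by rewrite scale0r.
  apply: (mulIf Bb0); rewrite mul0r -dotZl -Gb dot_adj.
  have -> : adjmx G = B - x^* *: adjmx B.
    by apply/matrixP=> i j; rewrite !mxE rmorphB rmorphM /= conjCK.
  by rewrite mulmxBl -scalemxAl xb0 scalerA xx1 scale1r subrr dot0r.
apply/subr0_eq/matrixP=> i j; rewrite [RHS]mxE.
by have /matrixP/(_ i 0) := G0 (delta_mx j 0); rewrite -colE !mxE.
Qed.

Section Pencil.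
Variables (m k : nat) (A : 'I_k -> 'M[C]_m).
Implicit Types (a b y v : 'cV[C]_m) (c d : 'cV[C]_k).

Definition pencil c : 'M[C]_m := \sum_j c j 0 *: A j.

Definition evmx a : 'M[C]_(m, k) := \matrix_(i, j) (A j *m a) i 0.

Definition form a b : 'cV[C]_k := \col_j dot (A j *m a) b.

Lemma pencil_linear t c d : pencil (t *: c + d) = t *: pencil c + pencil d.
Proof.
rewrite /pencil scaler_sumr -big_split; apply: eq_bigr => j _.
by rewrite !mxE scalerDl scalerA.
Qed.

Lemma pencil_delta j : pencil (delta_mx j 0) = A j.
Proof.
rewrite /pencil (bigD1 j) //= big1 ?addr0 => [|i ij]; rewrite mxE ?eqxx ?scale1r//.
by rewrite (negPf ij) scale0r.
Qed.

Lemma evmx_mul a c : evmx a *m c = pencil c *m a.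
Proof.
rewrite mulmx_suml; apply/matrixP=> i j; rewrite ord1 !mxE summxE.
by apply: eq_bigr => l _; rewrite -scalemxAl [RHS]mxE !mxE mulrC.
Qed.

Lemma dot_pencil c a b : dot (pencil c *m a) b = \sum_j c j 0 * form a b j 0.
Proof.
rewrite mulmx_suml dot_suml; apply: eq_bigr => j _.
by rewrite mxE -scalemxAl dotZl.
Qed.

Hypothesis herm : forall j, adjmx (A j) = A j.

Lemma adj_pencil c : adjmx (pencil c) = pencil (cmx c).
Proof.
apply/matrixP=> i j; rewrite !mxE !summxE rmorph_sum; apply: eq_bigr => l _.
by rewrite !mxE rmorphM /= -{2}(herm l) !mxE.
Qed.

Lemma formC a b : form b a = cmx (form a b).
Proof.
by apply/matrixP=> j l; rewrite ord1 !mxE -dotC dot_adj herm.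
Qed.

Lemma form_evmx a b : form b a = adjmx (evmx a) *m b.
Proof.
apply/matrixP=> j l; rewrite ord1 !mxE dot_adj herm.
by apply: eq_bigr => i _; rewrite !mxE mulrC.
Qed.

End Pencil.
End Hermitian.

(** * Rank and minors *)

Section Rank.
Variable F : fieldType.

Lemma rank_sandwich p q (M : 'M[F]_(p, q)) :
  exists L : 'M_(\rank M, p), exists N : 'M_(q, \rank M), L *m M *m N = 1%:M.
Proof.
exists (pinvmx (col_base M)), (pinvmx (row_base M)).
have -> : pinvmx (col_base M) *m M = row_base M.
  transitivity (pinvmx (col_base M) *m (col_base M *m row_base M)).
    by rewrite mulmx_base.
  by rewrite mulmxA mulVpmx ?col_base_full // mul1mx.
by rewrite mulmxVp ?row_base_free.
Qed.

Lemma det_sandwich_rank r p q (L : 'M[F]_(r, p)) M (N : 'M_(q, r)) :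
  \det (L *m M *m N) != 0 -> (r <= \rank M)%N.
Proof.
rewrite -unitfE -[_ \is a _]/(L *m M *m N \in unitmx) -row_free_unit.
move=> /eqP {1}<-; apply: leq_trans (mxrankM_maxl _ _) _.
exact: mxrankM_maxr.
Qed.

Lemma ker_line p q (M : 'M[F]_(p, q)) : (\rank M).+1 = q ->
  exists2 d : 'cV_q, d != 0 &
    M *m d = 0 /\ forall c : 'cV_q, M *m c = 0 -> exists t, c = t *: d.
Proof.
move=> rM; pose K := kermx M^T.
have rK : \rank K = 1%N by rewrite mxrank_ker mxrank_tr -[X in (X - _)%N]rM subSnn.
have K0 : nz_row K != 0 by rewrite nz_row_eq0 -mxrank_eq0 rK.
exists (nz_row K)^T; first by rewrite -(inj_eq trmx_inj) trmxK trmx0.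
split=> [|c Mc].
  by apply: trmx_inj; rewrite trmx_mul trmxK trmx0; apply/sub_kermxP/nz_row_sub.
have /eqmxP eqK : (nz_row K == K)%MS.
  by rewrite -(geq_leqif (mxrank_leqif_eq (nz_row_sub K))) rK rank_rV K0.
have /sub_rVP[t ct] : (c^T <= nz_row K)%MS.
  by rewrite eqK; apply/sub_kermxP; rewrite -trmx_mul Mc trmx0.
by exists t; apply: trmx_inj; rewrite ct linearZ /= trmxK.
Qed.

Lemma solve_mulmx p q (M : 'M[F]_(p, q)) (s : 'cV_p) :
  (forall c : 'rV_p, c *m M = 0 -> c *m s = 0) -> exists x : 'cV_q, s = M *m x.
Proof.
move=> Ms; have /submxP[x sx] : (s^T <= M^T)%MS.
  rewrite submxE; apply/eqP/trmx_inj; rewrite trmx_mul trmxK trmx0.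
  apply/row_matrixP=> i; rewrite row_mul row0; apply: Ms.
  suff cM : (cokermx M^T)^T *m M = 0 by rewrite -row_mul cM row0.
  by apply: trmx_inj; rewrite trmx_mul trmxK mulmx_coker trmx0.
by exists x^T; apply: trmx_inj; rewrite trmx_mul trmxK.
Qed.

(** A column of the cokernel of the two rows separates some basis vector from
their span. *)
Lemma nsub_span2 q (d e : 'cV[F]_q) : (2 < q)%N ->
  exists c : 'cV_q, forall s t, c != s *: d + t *: e.
Proof.
move=> q2; pose D := col_mx d^T e^T.
have : (\rank (cokermx D) != 0)%N.
  rewrite mxrank_coker subn_eq0 -ltnNge; apply: leq_ltn_trans q2.
  exact: rank_leq_row.
rewrite mxrank_eq0 => D0.
have [i /eqP Di] : exists i, row i (cokermx D) != 0.
  apply/existsP; apply: contraNT D0 => /existsPn h; apply/eqP/row_matrixP=> i.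
  by rewrite row0; apply/eqP; move: (h i); rewrite negbK.
exists (delta_mx i 0) => s t; apply/eqP => /(congr1 trmx).
rewrite trmx_delta linearD !linearZ /= => /(congr1 (mulmx^~ (cokermx D))).
rewrite -rowE mulmxDl -!scalemxAl.
have /eqP : D *m cokermx D = 0 by rewrite mulmx_coker.
rewrite mul_col_mx col_mx_eq0 => /andP[/eqP -> /eqP ->].
by rewrite !scaler0 addr0 => /Di.
Qed.

End Rank.

Section Gram.
Variable C : numClosedFieldType.

(** The matrix in question is [L M N] with the [r i] as conjugate rows of [L] and
the [c j] as columns of [N], so its rank is at most that of [M]. *)
Lemma gram_det m k n (M : 'M[C]_(m, k)) (c : 'I_n -> 'cV_k) (r : 'I_n -> 'cV_m) :
  (\rank M < n)%N -> \det (\matrix_(i, j) dot (M *m c j) (r i)) = 0.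
Proof.
move=> rM; apply/eqP; apply: contraTT rM => det0; rewrite -leqNgt.
pose L := \matrix_(i < n, l < m) (r i l 0)^*.
pose N := \matrix_(l < k, j < n) c j l 0.
apply: (@det_sandwich_rank _ n _ _ L _ N).
suff -> : L *m M *m N = \matrix_(i, j) dot (M *m c j) (r i) by [].
apply/matrixP=> i j; rewrite -mulmxA !mxE; apply: eq_bigr => l _.
rewrite !mxE mulrC; congr (_ * _); apply: eq_bigr => s _.
by rewrite mxE.
Qed.

Lemma minor2_rank m k (M : 'M[C]_(m, k)) c1 c2 r1 r2 :
  (\rank M < 2)%N -> minor2 r1 r2 (M *m c1) (M *m c2) = 0.
Proof.
move=> /(@gram_det _ _ 2 M (tnth [tuple c1; c2]) (tnth [tuple r1; r2])).
rewrite (expand_det_row _ 0) !big_ord_recl big_ord0 /cofactor !det_mx11 !mxE /=.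
by rewrite !(tnth_nth 0) /= => <-; rewrite /minor2; ring.
Qed.

Lemma minor3_rank m k (M : 'M[C]_(m, k)) c1 c2 c3 r1 r2 r3 :
  (\rank M < 3)%N -> minor3 r1 r2 r3 (M *m c1) (M *m c2) (M *m c3) = 0.
Proof.
move=> /(@gram_det _ _ 3 M (tnth [tuple c1; c2; c3]) (tnth [tuple r1; r2; r3])).
rewrite (expand_det_row _ ord_max) !big_ord_recl big_ord0 /cofactor.
do 3! rewrite (expand_det_row _ 0) !big_ord_recl big_ord0 /cofactor !det_mx11.
rewrite !mxE /= !(tnth_nth 0) /= => <-; rewrite /minor3 /minor2; ring.
Qed.

Lemma rank_minor m k (M : 'M[C]_(m, k)) : (1 < \rank M)%N ->
  exists c1 c2 r1 r2, minor2 r1 r2 (M *m c1) (M *m c2) != 0.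
Proof.
move=> rM; apply: contrapT => nominor.
have min0 c1 c2 r1 r2 : minor2 r1 r2 (M *m c1) (M *m c2) = 0.
  apply: contrapT => h; apply: nominor; exists c1, c2, r1, r2; exact/eqP.
have [c Mc] : exists c : 'cV_k, M *m c != 0.
  apply: contrapT => noc; move: rM; suff -> : M = 0 by rewrite mxrank0.
  apply/matrixP=> i j; have /matrixP/(_ i 0) : M *m delta_mx j (0 : 'I_1) = 0.
    by apply: contrapT => h; apply: noc; exists (delta_mx j 0); apply/eqP.
  by rewrite -colE !mxE.
have /choice[f Mf] (j : 'I_k) : exists x, M *m delta_mx j 0 = x *: (M *m c).
  exact: minor2_eq0_line.
suff MM : M = M *m c *m (\row_j f j).
  by move: rM; rewrite MM leqNgt ltnS (mulmx_max_rank (M *m c)).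
apply/matrixP=> i j; have /matrixP/(_ i 0) := Mf j; rewrite -colE mxE => ->.
by rewrite [RHS]mxE big_ord1 !mxE mulrC.
Qed.

End Gram.

(** Three values of a quadratic polynomial determine its constant term; the value
at [0] itself is not used because the polynomials met below are only known to
vanish after multiplication by [t]. *)
Lemma quad_eq0 (C : numFieldType) (p0 p1 p2 : C) :
  (forall t, t != 0 -> p0 + t * p1 + t ^+ 2 * p2 = 0) -> p0 = 0.
Proof.
move=> q0; suff /eqP : p0 *+ 3 = 0 by rewrite mulrn_eq0 /= => /eqP.
pose s t := p0 + t * p1 + t ^+ 2 * p2.
have -> : p0 *+ 3 = s 1 *+ 3 + s (- 1) - s 2%:R by rewrite /s; ring.
by rewrite /s !q0 ?oppr_eq0 ?oner_neq0 ?pnatr_eq0 // mul0rn addr0 subrr.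
Qed.

(** * T(a)^F vanishes at points of generic rank *)

Section Tset.
Variable C : numClosedFieldType.
Variables (m k : nat) (A : 'I_k -> 'M[C]_m).
Implicit Types (a b x y v : 'cV[C]_m) (c d : 'cV[C]_k) (s t : C).

Definition inT a y := exists x, form A x a + form A a y = 0.

Definition T_orth a x := forall y, inT a y -> form A x y = 0.

Hypothesis herm : forall j, adjmx (A j) = A j.
Hypothesis indep : forall c, pencil A c = 0 -> c = 0.
Hypothesis nondeg : forall x, (forall z, form A z x = 0) -> x = 0.

Local Notation P := (pencil A).
Local Notation M := (evmx A).

Lemma nondeg_pencil x : (forall c, P c *m x = 0) -> x = 0.
Proof.
move=> Px; apply: nondeg => z; apply/matrixP=> j l; rewrite ord1 !mxE.
by rewrite dot_adj herm -(pencil_delta A j) Px dot0r.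
Qed.

Lemma nondeg_form x : (forall y, form A x y = 0) -> x = 0.
Proof.
move=> h; apply: nondeg => z; rewrite (formC herm).
by rewrite h cmx0.
Qed.

(** The range of [F a] is that of [y |-> conj (M(a)^* y)]; it is cut out by the
kernel of [M(a)]. *)
Lemma form_image a (e : 'cV[C]_k) :
  (forall c, M a *m c = 0 -> \sum_j c j 0 * e j 0 = 0) -> exists y, e = form A a y.
Proof.
move=> h; have [c'|y My] := @solve_mulmx _ _ _ (adjmx (M a)) (cmx e).
  move=> /(congr1 (@adjmx C _ _)); rewrite adjmxM adjmxK adjmx0 => /h c0.
  apply/matrixP=> i j; rewrite !ord1 mxE [RHS]mxE.
  rewrite -[LHS]conjCK rmorph_sum /= (eq_bigr (fun l => (adjmx c') l 0 * e l 0)).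
    by rewrite c0 rmorph0.
  by move=> l _; rewrite rmorphM /= !mxE conjCK.
by exists y; rewrite (formC herm) (form_evmx herm) -My cmxK.
Qed.

Lemma inT_ker a y :
  (forall c, M a *m c = 0 -> dot (P (cmx c) *m a) y = 0) -> inT a y.
Proof.
move=> h; have [c /h|x ax] := @form_image a (- cmx (form A a y)).
  rewrite dot_pencil => c0; rewrite -[LHS]conjCK rmorph_sum /=.
  rewrite (eq_bigr (fun l => - ((cmx c) l 0 * form A a y l 0))).
    by rewrite sumrN c0 oppr0 rmorph0.
  move=> l _; have -> : (- cmx (form A a y)) l 0 = - (form A a y l 0)^*.
    by rewrite mxE; congr (- _); rewrite mxE.
  by rewrite rmorphM /= rmorphN /= conjCK mulrN [cmx c l 0]mxE.
by exists x; rewrite (formC herm) -ax -scaleN1r cmxZ cmxK rmorphN1 scaleN1r addNr.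
Qed.

(** Here [F(., a)] is onto, so that [T(a)] is the whole space. *)
Lemma T_orth_full a x : \rank (M a) = k -> T_orth a x -> x = 0.
Proof.
move=> rk h; apply: nondeg_form => y; apply: h; apply: inT_ker => c Mc.
suff -> : c = 0.
  by rewrite cmx0 -evmx_mul mulmx0 dot0l.
have : row_free (M a)^T by rewrite /row_free mxrank_tr rk.
move=> /row_free_inj inj; apply: trmx_inj; apply: inj.
by rewrite -trmx_mul Mc trmx0 linear0 mul0mx.
Qed.

(** Since [P c] and [P (cmx c)] are adjoint, this is [adj_dep] for the pencil. *)
Lemma pencil_conj_indep c : (forall t, cmx c != t *: c) ->
  exists b r1 r2, minor2 r1 r2 (P c *m b) (P (cmx c) *m b) != 0.
Proof.
move=> cc; apply: contrapT => h.
have [b r1 r2|t] := @adj_dep C m (P c).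
  rewrite adj_pencil //; apply: contrapT => hb; apply: h.
  by exists b, r1, r2; exact/eqP.
rewrite (adj_pencil herm) => ct; have /eqP[] := cc t.
apply/subr0_eq/indep; rewrite addrC -scaleNr pencil_linear ct.
by rewrite scaleNr addNr.
Qed.

Section Hyperplane.
Hypothesis k_gt2 : (2 < k)%N.
Hypothesis rank_le2 : forall b, (\rank (M b) < 3)%N.
Variables (a : 'cV[C]_m) (d : 'cV[C]_k).
Hypothesis rank_a : (1 < \rank (M a))%N.
Hypothesis Mad : M a *m d = 0.
Hypothesis kerMa : forall c, M a *m c = 0 -> exists t, c = t *: d.

Let minor3_eq0 b c1 c2 c3 r1 r2 r3 :
  minor3 r1 r2 r3 (P c1 *m b) (P c2 *m b) (P c3 *m b) = 0.
Proof. by rewrite -!evmx_mul; apply: minor3_rank. Qed.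

Let v := P (cmx d) *m a.

(** [T(a)] contains the orthogonal of [v], since the kernel of [M(a)] is spanned
by [d]. *)
Lemma T_orth_line x : T_orth a x -> forall c, exists t, P c *m x = t *: v.
Proof.
move=> Tx c; apply: dot_orth_line => y vy; rewrite dot_pencil Tx.
  by apply: big1 => j _; rewrite mxE mulr0.
apply: inT_ker => e /kerMa[t ->]; rewrite cmxZ -[_ *: _]addr0.
by rewrite pencil_linear mulmxDl -scalemxAl dotDl dotZl vy mulr0 add0r
  -evmx_mul mulmx0 dot0l.
Qed.

(** The functional [dot _ x] kills every [P c *m a], because
[<v, a> = <a, A_d a> = 0].  It is used as the third functional of the
vanishing minors: these collapse to a product of its value by a 2 x 2 minor
that is known not to vanish, first at [A_d b], next at [A_d^* b], and finally
at every [P c *m b]. *)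
Lemma T_orth_hyperplane x : T_orth a x -> x = 0.
Proof.
move=> Tx; have line := T_orth_line Tx.
have [v0|v0] := eqVneq v 0.
  by apply: nondeg_pencil => c; have [t ->] := line c; rewrite v0 scaler0.
have Pda : P d *m a = 0 by rewrite -evmx_mul.
have va : dot v a = 0 by rewrite /v -(adj_pencil herm) dot_adj adjmxK Pda dot0r.
have xiW c : dot (P c *m a) x = 0.
  rewrite dot_adj (adj_pencil herm) dotC.
  by have [t ->] := line (cmx c); rewrite dotZl va mulr0 rmorph0.
have [c1 [c2 [r1 [r2 min_a]]]] := rank_minor rank_a.
rewrite !evmx_mul in min_a.
(* the minor of [P d], [P c1], [P c2] at [a + t b], divided by [t], at [t = 0] *)
have xid b : dot (P d *m b) x = 0.
  apply: (mulIf min_a); rewrite mul0r.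
  apply: (@quad_eq0 C _
    (dot (P d *m b) x * (minor2 r1 r2 (P c1 *m a) (P c2 *m b)
         + minor2 r1 r2 (P c1 *m b) (P c2 *m a))
       - dot (P c1 *m b) x * minor2 r1 r2 (P d *m b) (P c2 *m a)
       + dot (P c2 *m b) x * minor2 r1 r2 (P d *m b) (P c1 *m a))
    (minor3 r1 r2 x (P d *m b) (P c1 *m b) (P c2 *m b))) => t t0.
  apply: (mulfI t0); rewrite mulr0 -(minor3_eq0 (a + t *: b) d c1 c2 r1 r2 x).
  rewrite !mulmxDr Pda -!scalemxAr add0r /minor3 /minor2 !dotDl !dotZl !xiW; ring.
have Pdcx : P (cmx d) *m x = 0.
  apply: dot_eq0l => b; rewrite dot_adj (adj_pencil herm) cmxK.
  by rewrite dotC xid rmorph0.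
(* if [P d *m x] were a nonzero multiple of [v], a third direction [c] could be
   corrected by [d] so as to kill [x]; moving [b] by [x] then brings [v] into
   the minor of [cmx d], [c], [d] *)
have Pdx : P d *m x = 0.
  have [//|Pdx0] := eqVneq (P d *m x) 0.
  have [l dl] := line d.
  have l0 : l != 0 by apply: contra_neq Pdx0 => l0; rewrite dl l0 scale0r.
  have [c' cspan] := nsub_span2 d (cmx d) k_gt2.
  have [l' dl'] := line c'.
  pose c := (- (l' / l)) *: d + c'.
  have Pcx : P c *m x = 0.
    rewrite pencil_linear mulmxDl -scalemxAl dl dl' scalerA -scalerDl.
    by rewrite mulNr divfK // addNr scale0r.
  have dep b (s1 s2 s3 : 'cV_m) : minor3 s1 s2 s3 (P (cmx d) *m b) (P c *m b) v = 0.
    have := minor3_eq0 (b + x) (cmx d) c d s1 s2 s3.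
    have := minor3_eq0 b (cmx d) c d s1 s2 s3.
    rewrite !mulmxDr Pdcx Pcx dl !addr0 => h1 h2.
    apply: (mulfI l0); rewrite mulr0 -[RHS](subrr (0 : C)) -{1}h2 -{1}h1.
    rewrite /minor3 /minor2 !dotDl !dotZl; ring.
  have xiv : dot v x = 0 by exact: xiW.
  have [/existsNP[s1 /existsNP[s2 /eqP min_s]]|min0] :=
    pselect (~ forall s1 s2 : 'cV_m, minor2 s1 s2 v (P c *m a) = 0).
    apply: dot_eq0l => b; rewrite dot_adj (adj_pencil herm) dotC.
    suff -> : dot (P (cmx d) *m b) x = 0 by rewrite rmorph0.
    apply: (mulIf min_s); rewrite mul0r.
    rewrite -[RHS](subrr (0 : C)) -{1}(dep b s1 s2 x) -{1}(dep (a + b) s1 s2 x).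
    rewrite !mulmxDr -/v /minor3 /minor2 !dotDl !xiW ?xiv; ring.
  (* else [c - t (cmx d)] is a multiple of [d], although [c'] was chosen outside
     the span of [d] and [cmx d] *)
  have [t ct] := minor2_eq0_line v0 (contrapT min0).
  have [|s cs] := kerMa (c := (- t) *: cmx d + c).
    by rewrite evmx_mul pencil_linear mulmxDl -scalemxAl ct -/v scaleNr addNr.
  case/eqP: (cspan (s + l' / l) t).
  rewrite scalerDl -cs /c !scaleNr; apply/matrixP=> i j; rewrite !mxE; ring.
have [e|b [s1 [s2 min_b]]] := @pencil_conj_indep d.
  apply: contra_neq v0 => de; rewrite /v de -[_ *: _]addr0 pencil_linear.
  by rewrite mulmxDl -scalemxAl Pda scaler0 add0r -evmx_mul mulmx0.
(* the range of [P c] is reached through the plane spanned by [P d *m y] and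
   [P (cmx d) *m y], which is not degenerate at [y = b] *)
have prod0 c y :
    dot (P c *m y) x * minor2 s1 s2 (P d *m y) (P (cmx d) *m y) = 0.
  rewrite -[RHS](minor3_eq0 y d (cmx d) c s1 s2 x) /minor3 xid.
  rewrite (dot_adj (P (cmx d)) y) (adj_pencil herm) cmxK Pdx dot0r; ring.
apply: nondeg_pencil => c; apply: dot_eq0l => y.
rewrite dot_adj (adj_pencil herm) dotC; set c' := cmx c.
suff -> : dot (P c' *m y) x = 0 by rewrite rmorph0.
have xib : dot (P c' *m b) x = 0 by apply: (mulIf min_b); rewrite mul0r prod0.
apply: (mulIf min_b); rewrite mul0r.
pose mn u w := minor2 s1 s2 (P d *m u) (P (cmx d) *m w).
apply: (@quad_eq0 C _ (dot (P c' *m y) x * (mn b y + mn y b))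
                       (dot (P c' *m y) x * mn y y)) => t t0.
apply: (mulfI t0); rewrite mulr0 -(prod0 c' (b + t *: y)) /mn /minor2.
rewrite !mulmxDr -!scalemxAr !dotDl !dotZl xib; ring.
Qed.
End Hyperplane.
End Tset.

(** * Polynomial functions along curves *)

Section Polyfun.
Variable C : numClosedFieldType.
Implicit Types f g : C -> C.

Definition polyfun f := exists p : {poly C}, forall t, f t = p.[t].

Lemma polyfun_ext f g : f =1 g -> polyfun f -> polyfun g.
Proof. by move=> fg [p fp]; exists p => t; rewrite -fg. Qed.

Lemma polyfun_cst c : polyfun (fun=> c).
Proof. by exists c%:P => t; rewrite hornerC. Qed.

Lemma polyfun_id : polyfun id.
Proof. by exists 'X => t; rewrite hornerX. Qed.

Lemma polyfunD f g : polyfun f -> polyfun g -> polyfun (fun t => f t + g t).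
Proof. by move=> [p fp] [q gq]; exists (p + q) => t; rewrite hornerD fp gq. Qed.

Lemma polyfunM f g : polyfun f -> polyfun g -> polyfun (fun t => f t * g t).
Proof. by move=> [p fp] [q gq]; exists (p * q) => t; rewrite hornerM fp gq. Qed.

Lemma polyfun_sum I (s : seq I) (F : I -> C -> C) : (forall i, polyfun (F i)) ->
  polyfun (fun t => \sum_(i <- s) F i t).
Proof.
move=> pF; elim: s => [|i s IH].
  by apply: polyfun_ext (polyfun_cst 0) => t; rewrite big_nil.
by apply: polyfun_ext (polyfunD (pF i) IH) => t; rewrite big_cons.
Qed.

Lemma polyfun_prod I (s : seq I) (F : I -> C -> C) : (forall i, polyfun (F i)) ->
  polyfun (fun t => \prod_(i <- s) F i t).
Proof.
move=> pF; elim: s => [|i s IH].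
  by apply: polyfun_ext (polyfun_cst 1) => t; rewrite big_nil.
by apply: polyfun_ext (polyfunM (pF i) IH) => t; rewrite big_cons.
Qed.

Lemma polyfunX f n : polyfun f -> polyfun (fun t => f t ^+ n).
Proof. by move=> [p fp]; exists (p ^+ n) => t; rewrite horner_exp fp. Qed.

(** The conjugate of the argument makes the conjugate function holomorphic again;
this is how antiholomorphic dependence is handled throughout. *)
Lemma polyfun_conj f : polyfun f -> polyfun (fun t => (f t^*)^*).
Proof.
by move=> [p fp]; exists (map_poly Num.conj p) => t; rewrite fp -horner_map /= conjCK.
Qed.

Lemma poly_eq0_inj (p : {poly C}) (x : nat -> C) :
  injective x -> (forall n, p.[x n] = 0) -> p = 0.
Proof.
move=> injx p0; apply/eqP; apply: contraT => nz.
pose s : seq C := [seq x n | n <- iota 0 (size p)].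
have := @max_poly_roots _ p s nz; rewrite size_map size_iota ltnn; apply.
  by apply/allP=> _ /mapP[n _ ->]; rewrite /root p0.
by rewrite map_inj_uniq ?iota_uniq.
Qed.

Lemma poly_eq0_nat (p : {poly C}) : (forall n, p.[n.+1%:R] = 0) -> p = 0.
Proof. by apply: poly_eq0_inj => i j /eqP; rewrite eqr_nat => /eqP[]. Qed.

(** The sample points [n.+1] serve twice: they are real, as polarisation needs,
and nonzero, as division by the parameter needs. *)
Lemma polyfun_eq0 f : polyfun f -> (forall n, f n.+1%:R = 0) -> forall t, f t = 0.
Proof.
move=> [p fp] f0 t; rewrite fp (@poly_eq0_nat p) ?horner0 // => n.
by rewrite -fp f0.
Qed.

Lemma polyfun_mul_eq0 f g : polyfun f -> polyfun g ->
  (forall n, f n.+1%:R * g n.+1%:R = 0) -> (forall t, f t = 0) \/ (forall t, g t = 0).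
Proof.
move=> [p fp] [q gq] pq0; have /eqP : p * q = 0.
  by apply: poly_eq0_nat => n; rewrite hornerM -fp -gq.
rewrite mulf_eq0 => /orP[]/eqP z; [left|right] => t.
  by rewrite fp z horner0.
by rewrite gq z horner0.
Qed.

Lemma polyfun_det n (M : C -> 'M[C]_n) : (forall i j, polyfun (fun t => M t i j)) ->
  polyfun (fun t => \det (M t)).
Proof.
move=> pM; apply: polyfun_sum => s; apply: polyfunM; first exact: polyfun_cst.
by apply: polyfun_prod => i; exact: pM.
Qed.

Lemma polyfun_meval n (p : mpoly n C) (v : C -> 'I_n -> C) :
  (forall i, polyfun (v^~ i)) -> polyfun (fun t => meval (v t) p).
Proof.
move=> pv; apply: (@polyfun_ext (fun t =>
    \sum_(mu <- msupp p) mcoeff mu p * \prod_i v t i ^+ mu i)).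
  by move=> t; rewrite mevalE.
apply: polyfun_sum => mu; apply: polyfunM; first exact: polyfun_cst.
by apply: polyfun_prod => i; apply: polyfunX.
Qed.

Lemma digits_inj N n (f g : 'I_n -> nat) :
  (forall i, (f i < N)%N) -> (forall i, (g i < N)%N) ->
  (\sum_i f i * N ^ i = \sum_i g i * N ^ i)%N -> f =1 g.
Proof.
elim: n f g => [|n IH] f g fN gN; first by move=> _ [].
rewrite !big_ord_recl !expn0 !muln1.
have shift (h : 'I_n.+1 -> nat) : (\sum_(i < n) h (lift ord0 i) * N ^ lift ord0 i =
    (\sum_(i < n) h (lift ord0 i) * N ^ i) * N)%N.
  by rewrite big_distrl; apply: eq_bigr => i _; rewrite /= expnS; ring.
rewrite !shift => fg.
have fg0 : f ord0 = g ord0.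
  by have := congr1 (modn^~ N) fg; rewrite !(addnC (_ ord0)) !modnMDl !modn_small.
have N0 : (0 < N)%N by apply: leq_ltn_trans (fN ord0).
move: fg; rewrite fg0 => /addnI/eqP; rewrite eqn_pmul2r // => /eqP/IH fg i.
case: (unliftP ord0 i) => [j ->|-> //].
by apply: fg => l; [exact: fN|exact: gN].
Qed.

(** Kronecker substitution: at [v_i = t ^ (N ^ i)], with [N] above the degree,
distinct monomials become distinct powers of [t]. *)
Lemma meval_eq0 n (p : mpoly n C) : (forall v, meval v p = 0) -> p = 0.
Proof.
move=> p0; pose e (mu : multinom n) := (\sum_i mu i * msize p ^ i)%N.
pose q := \sum_(mu <- msupp p) mcoeff mu p *: 'X^(e mu).
have q0 t : q.[t] = 0.
  rewrite -(p0 (fun i => t ^+ (msize p ^ i))) mevalE horner_sum.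
  apply: eq_bigr => mu _; rewrite hornerZ hornerXn; congr (_ * _).
  rewrite /e -prodrXr; apply: eq_bigr => i _.
  by rewrite -exprM mulnC.
have qz : q = 0 by apply: poly_eq0_nat => j; exact: q0.
apply/mpolyP=> mu; rewrite mcoeff0.
have [mu_p|] := boolP (mu \in msupp p); last by rewrite mcoeff_msupp negbK => /eqP.
have := congr1 (fun r : {poly C} => r`_(e mu)) qz.
rewrite coef0 coef_sum (bigD1_seq mu) ?msupp_uniq //= coefZ coefXn eqxx mulr1.
rewrite big1_seq ?addr0 // => nu /andP[nu_mu nu_p].
rewrite coefZ coefXn; case: eqP => [enu|]; last by rewrite mulr0.
have small la : la \in msupp p -> forall i, (la i < msize p)%N.
  move=> la_p i; apply: leq_ltn_trans (msize_mdeg_lt la_p).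
  by rewrite mdegE (bigD1 i) //= leq_addr.
case/eqP: nu_mu; apply/mnmP => i.
exact: (esym (digits_inj (small _ mu_p) (small _ nu_p) enu i)).
Qed.

(** Spell the monomial as a list of variables with repetition. *)
Lemma quadratic_monomial n (mu : 'I_n -> nat) : (\sum_i mu i)%N = 2 ->
  exists i j, forall w : 'I_n -> C, \prod_l w l ^+ mu l = w i * w j.
Proof.
move=> mu2; pose s := flatten [seq nseq (mu l) l | l <- index_enum 'I_n].
have sE w : \prod_l w l ^+ mu l = \prod_(l <- s) w l :> C.
  rewrite /s big_flatten big_map; apply: eq_bigr => l _.
  by rewrite big_nseq -Monoid.iteropE.
have : size s = 2.
  rewrite size_flatten sumnE /shape -map_comp big_map -[RHS]mu2.
  by apply: eq_bigr => l _; rewrite /= size_nseq.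
case: s sE => [|i [|j []]] // sE _; exists i, j => w.
by rewrite sE !big_cons big_nil mulr1.
Qed.
End Polyfun.

(** * The tangency condition and the quadratic map f(0, w) *)

Section Curves.
Variable C : numClosedFieldType.

Definition polycurve n (z : C -> 'cV[C]_n) := forall i, polyfun (fun t => z t i 0).

Lemma polycurve_ext n (y z : C -> 'cV[C]_n) : y =1 z -> polycurve y -> polycurve z.
Proof. by move=> yz py i; apply: polyfun_ext (py i) => t; rewrite yz. Qed.

Lemma polycurve_cst n (a : 'cV[C]_n) : polycurve (fun=> a).
Proof. by move=> i; exact: polyfun_cst. Qed.

Lemma polycurveD n (y z : C -> 'cV[C]_n) :
  polycurve y -> polycurve z -> polycurve (fun t => y t + z t).
Proof.
by move=> py pz i; apply: polyfun_ext (polyfunD (py i) (pz i)) => t; rewrite mxE.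
Qed.

Lemma polycurveZ n h (z : C -> 'cV[C]_n) :
  polyfun h -> polycurve z -> polycurve (fun t => h t *: z t).
Proof.
by move=> ph pz i; apply: polyfun_ext (polyfunM ph (pz i)) => t; rewrite mxE.
Qed.

Lemma polycurve_line n (a b : 'cV[C]_n) : polycurve (fun t => a + t *: b).
Proof.
apply: polycurveD; first exact: polycurve_cst.
by apply: polycurveZ; [exact: polyfun_id|exact: polycurve_cst].
Qed.

Lemma polycurve_mulmx n p (B : 'M[C]_(p, n)) (z : C -> 'cV[C]_n) :
  polycurve z -> polycurve (fun t => B *m z t).
Proof.
move=> pz i; apply: (@polyfun_ext _ (fun t => \sum_j B i j * z t j 0)).
  by move=> t; rewrite mxE.
by apply: polyfun_sum => j; apply: polyfunM; [exact: polyfun_cst|exact: pz].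
Qed.

Lemma polyfun_dot n (y z : C -> 'cV[C]_n) : polycurve y -> polycurve z ->
  polyfun (fun t => dot (y t) (z t^*)).
Proof.
move=> py pz; apply: polyfun_sum => l; apply: polyfunM; first exact: py.
exact: polyfun_conj (pz l).
Qed.

Lemma polycurve_form m k (A : 'I_k -> 'M[C]_m) (y z : C -> 'cV[C]_m) :
  polycurve y -> polycurve z -> polycurve (fun t => form A (y t) (z t^*)).
Proof.
move=> py pz j.
apply: polyfun_ext (polyfun_dot (polycurve_mulmx (A j) py) pz) => t.
by rewrite mxE.
Qed.

Lemma polycurve_eq0 n (z : C -> 'cV[C]_n) : polycurve z ->
  (forall l, z l.+1%:R = 0) -> forall t, z t = 0.
Proof.
move=> pz z0 t; apply/matrixP=> i j; rewrite ord1 mxE.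
by apply: (polyfun_eq0 (pz i)) => l; rewrite z0 mxE.
Qed.

(** On the curve [t |-> (a + t b, a + t^* b)] the two arguments agree at real [t],
and [t = i] reaches an arbitrary pair [(z, y)]. *)
Lemma polarize n (z y : 'cV[C]_n) : exists a b,
  [/\ z = a + 'i *: b, y = a - 'i *: b & y = cmx z -> cmx a = a /\ cmx b = b].
Proof.
have i0 := neq0Ci C; have t0 : 2%:R != 0 :> C by rewrite pnatr_eq0.
exists (2^-1 *: (z + y)), ((2 * 'i)^-1 *: (z - y)); split.
- apply/matrixP=> i j; rewrite !mxE; by field; rewrite ?i0 ?t0.
- apply/matrixP=> i j; rewrite !mxE; by field; rewrite ?i0 ?t0.
move=> ->; split; apply/matrixP=> i j; rewrite !mxE rmorphM.
  by rewrite fmorphV rmorph_nat rmorphD /= conjCK addrC.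
rewrite fmorphV rmorphM /= rmorphB /= conjCK rmorph_nat conjCi.
by field; rewrite ?oppr_eq0 ?i0 ?t0.
Qed.

End Curves.

Section Form.
Variable C : numClosedFieldType.
Variables (m k : nat) (A : 'I_k -> 'M[C]_m).
Implicit Types (a b x y z : 'cV[C]_m).

Lemma formDl x y z : form A (x + y) z = form A x z + form A y z.
Proof. by apply/matrixP=> i j; rewrite !mxE mulmxDr dotDl. Qed.
Lemma formDr x y z : form A z (x + y) = form A z x + form A z y.
Proof. by apply/matrixP=> i j; rewrite !mxE dotDr. Qed.
Lemma formZl t x z : form A (t *: x) z = t *: form A x z.
Proof. by apply/matrixP=> i j; rewrite !mxE -scalemxAr dotZl. Qed.
Lemma formZr t x z : form A z (t *: x) = t^* *: form A z x.
Proof. by apply/matrixP=> i j; rewrite !mxE dotZr. Qed.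
Lemma form0l z : form A 0 z = 0.
Proof. by rewrite -(scale0r 0) formZl scale0r. Qed.
Lemma form0r z : form A z 0 = 0.
Proof. by rewrite -(scale0r 0) formZr rmorph0 scale0r. Qed.
End Form.

Section CRfield.
Variable C : numClosedFieldType.
Variables (m k : nat) (A : 'I_k -> 'M[C]_m).
Hypothesis herm : forall j, adjmx (A j) = A j.
Hypothesis nondeg : forall x, (forall z, form A z x = 0) -> x = 0.

Local Notation F := (form A).

Variables (f : 'cV[C]_m -> 'cV[C]_k -> 'cV[C]_m).
Variables (g : 'cV[C]_m -> 'cV[C]_k -> 'cV[C]_k).
Hypothesis f_poly : forall z w, polycurve z -> polycurve w ->
  polycurve (fun t => f (z t) (w t)).
Hypothesis g_poly : forall z w, polycurve z -> polycurve w ->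
  polycurve (fun t => g (z t) (w t)).
Hypothesis f_hom : forall t z w, f (t *: z) (t ^+ 2 *: w) = t ^+ 4 *: f z w.
Hypothesis g_hom : forall t z w, g (t *: z) (t ^+ 2 *: w) = t ^+ 5 *: g z w.

Let D z w y := g z w - (2 * 'i) *: F (f z w) y.

Hypothesis tangent : forall z u, cmx u = u ->
  cmx (D z (u + 'i *: F z z) z) = D z (u + 'i *: F z z) z.

(** The two sides differ by a polynomial in [t] along the curve of [polarize],
where [u] is moved in the same way; the tangency condition says that it
vanishes at real [t]. *)
Lemma segre z y u :
  D z (u + 'i *: F z y) y = cmx (D y (cmx u + 'i *: F y z) z).
Proof.
have [z0 [z1 [zE yE _]]] := polarize z y.
have [u0 [u1 [uE cuE]]] := polarize u (cmx u); move=> /(_ erefl)[u0r u1r].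
pose zt t := z0 + t *: z1.
pose D1 t := D (zt t) (u0 + t *: u1 + 'i *: F (zt t) (zt t^*)) (zt t^*).
have pz : polycurve zt by exact: polycurve_line.
have pw : polycurve (fun t => u0 + t *: u1 + 'i *: F (zt t) (zt t^*)).
  apply: polycurveD; first exact: polycurve_line.
  by apply: polycurveZ; [exact: polyfun_cst|exact: polycurve_form].
have pD : polycurve D1.
  apply: polycurve_ext (polycurveD (g_poly pz pw)
    (polycurveZ (polyfun_cst (- (2 * 'i))) (polycurve_form A (f_poly pz pw) pz))).
  by move=> t; rewrite /D1 /D scaleNr.
have pcD : polycurve (fun t => cmx (D1 t^*)).
  by move=> i; apply: polyfun_ext (polyfun_conj (pD i)) => t; rewrite [RHS]mxE.
have real0 n : D1 n.+1%:R - cmx (D1 (n.+1%:R)^*) = 0.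
  rewrite /D1 conjCK rmorph_nat tangent ?subrr // cmxD cmxZ u0r u1r.
  by rewrite rmorph_nat.
have pdif : polycurve (fun t => D1 t - cmx (D1 t^*)).
  apply: polycurve_ext (polycurveD pD (polycurveZ (polyfun_cst (-1)) pcD)).
  by move=> t; rewrite scaleN1r.
have := polycurve_eq0 pdif real0 'i; rewrite /D1 conjCK conjCi /zt scaleNr.
by rewrite -zE -yE -uE scaleNr -cuE => /subr0_eq.
Qed.

Let phi w := f 0 w.

Lemma phiZ s w : phi (s *: w) = s ^+ 2 *: phi w.
Proof.
have := f_hom (sqrtC s) 0 w; rewrite scaler0 sqrtCK /phi => ->.
by rewrite (exprM _ 2 2) sqrtCK.
Qed.

Lemma phiN w : phi (- w) = phi w.
Proof. by rewrite -scaleN1r phiZ sqrrN expr1n scale1r. Qed.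

Lemma phi0 : phi 0 = 0.
Proof. by rewrite -(scale0r 0) phiZ expr0n scale0r. Qed.

Lemma f_even z w : f (- z) w = f z w.
Proof.
have := f_hom (-1) z w; rewrite scaleN1r sqrrN expr1n scale1r => ->.
by rewrite -signr_odd expr0 scale1r.
Qed.

(** This is [segre] at [y = 0], where the weight of [g] being odd gives
[g 0 _ = 0]. *)
Lemma g_phi z u : g z u = (2 * 'i) *: F z (phi (cmx u)).
Proof.
have g0 w : g 0 w = 0.
  have := g_hom (-1) 0 w; rewrite scaleN1r oppr0 sqrrN expr1n scale1r.
  have -> : (-1) ^+ 5 = -1 :> C by rewrite -signr_odd expr1.
  rewrite scaleN1r => /eqP; rewrite -addr_eq0 -mulr2n -scaler_nat scaler_eq0.
  by rewrite pnatr_eq0 => /eqP.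
have := segre z 0 u; rewrite !form0r form0l !scaler0 !addr0 /D g0 sub0r form0r.
rewrite scaler0 subr0 => ->; rewrite -scaleNr cmxZ -(formC herm).
by rewrite rmorphN rmorphM /= conjCi rmorph_nat mulrN opprK.
Qed.

Lemma segre_f z y w :
  F z (phi (cmx w)) + F (phi (w - (2 * 'i) *: F z y)) y =
  F (f z w) y + F z (f y (cmx w + (2 * 'i) *: F y z)).
Proof.
have := segre z y (w - 'i *: F z y).
have -> : w - 'i *: F z y + 'i *: F z y = w by rewrite subrK.
have -> : cmx (w - 'i *: F z y) + 'i *: F y z = cmx w + (2 * 'i) *: F y z.
  rewrite cmxD -scaleNr cmxZ -(formC herm) rmorphN /= conjCi opprK.
  by rewrite -addrA -scalerDl; congr (_ + _ *: _); ring.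
rewrite /D !g_phi cmxB !cmxZ -!(formC herm) rmorphM /= conjCi rmorph_nat mulrN.
rewrite cmxD cmxZ cmxK -(formC herm) rmorphM /= conjCi rmorph_nat mulrN !scaleNr.
rewrite opprK => h; have i0 : 2 * 'i != 0 :> C.
  by rewrite mulf_neq0 ?neq0Ci ?pnatr_eq0.
apply: (scalerI i0); rewrite !scalerDr -[X in X + _](subrK ((2 * 'i) *: F (f z w) y)).
by rewrite h addrC !addrA subrr add0r addrC.
Qed.

(** [f] is even in [z] and the form is odd in it, so the difference of [segre_f]
at [z] and [- z] eliminates [f z w]. *)
Lemma segre_odd z y w :
  F z (f y (cmx w + (2 * 'i) *: F y z) + f y (cmx w - (2 * 'i) *: F y z)) =
  F z (phi (cmx w)) *+ 2
    + (F (phi (w - (2 * 'i) *: F z y)) y - F (phi (w + (2 * 'i) *: F z y)) y).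
Proof.
have := segre_f (- z) y w; have := segre_f z y w.
rewrite -[- z]scaleN1r !formZl !formZr rmorphN1 !scaleN1r !scalerN opprK f_even.
rewrite formDr => h1 h2.
have -> : F z (f y (cmx w + (2 * 'i) *: F y z)) =
    F z (phi (cmx w)) + F (phi (w - (2 * 'i) *: F z y)) y - F (f z w) y.
  by rewrite h1 [RHS]addrC addKr.
have -> : F z (f y (cmx w - (2 * 'i) *: F y z)) = F (f z w) y -
    (- F z (phi (cmx w)) + F (phi (w + (2 * 'i) *: F z y)) y).
  by rewrite h2 opprB [RHS]addrC subrK.
by rewrite addrA subrK opprD opprK addrACA.
Qed.

(** At [w = 0] the right-hand side of [segre_odd] vanishes.  Replacing [y] by
[t y] and [z] by [z / t] keeps [F y z] fixed, and [t = 0] turns [f (t y)] into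
[phi]. *)
Lemma form_phi_eq0 z y : F (phi (F y z)) z = 0.
Proof.
pose x := (2 * 'i) *: F y z.
pose h t := F (f (t *: y) x + f (t *: y) (- x)) z.
have ph : polycurve h.
  apply: polycurve_form; last exact: polycurve_cst.
  have py : polycurve (fun t => t *: y).
    by apply: polycurveZ; [exact: polyfun_id|exact: polycurve_cst].
  by apply: polycurveD; apply: f_poly => //; exact: polycurve_cst.
have h0 n : h n.+1%:R = 0.
  have n0 : n.+1%:R != 0 :> C by rewrite pnatr_eq0.
  have := segre_odd (n.+1%:R^-1 *: z) (n.+1%:R *: y) 0.
  rewrite cmx0 !add0r !phiN phi0 form0r mul0rn subrr add0r.
  rewrite (formZr A _ z) (formZl A _ y) !scalerA fmorphV rmorph_nat divfK // -/x.
  rewrite formZl => /eqP; rewrite scaler_eq0 invr_eq0 (negPf n0) /= => /eqP zh.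
  by rewrite /h (formC herm) zh cmx0.
have := polycurve_eq0 ph h0 0; rewrite /h scale0r -/(phi x) -/(phi (- x)) phiN.
rewrite formDl phiZ formZl -scalerDl -mulr2n => /eqP.
rewrite scaler_eq0 mulrn_eq0 expf_eq0 mulf_eq0 pnatr_eq0.
by rewrite (negPf (neq0Ci _)) /= => /eqP.
Qed.

(** Let [F x a + F a y = 0].  Then [F a (a + t y) = F (a - t x) a], so that
[form_phi_eq0] makes the value of [phi] at this vector orthogonal both to
[a + t y] and to [a], hence to [y]; at [t = 0] the vector is [F a a]. *)
Lemma phi_diag_eq0 a : (forall x, T_orth A a x -> x = 0) -> phi (F a a) = 0.
Proof.
apply=> y [x xy].
pose h t := F (phi (F (a - t *: x) a)) y.
have ph : polycurve h.
  apply: polycurve_form; last exact: polycurve_cst.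
  apply: f_poly; first exact: polycurve_cst.
  apply: polycurve_form; last exact: polycurve_cst.
  by apply: polycurve_ext (polycurve_line a (- x)) => t; rewrite scalerN.
have h0 n : h n.+1%:R = 0.
  have n0 : n.+1%:R != 0 :> C by rewrite pnatr_eq0.
  have := form_phi_eq0 (a + n.+1%:R *: y) a.
  have -> : F a (a + n.+1%:R *: y) = F (a - n.+1%:R *: x) a.
    rewrite formDr formZr rmorph_nat -[a - _]/(a + _) formDl -scalerN formZl.
    rewrite -scaleN1r formZl scaleN1r; congr (_ + _ *: _).
    by apply/eqP; rewrite -addr_eq0 addrC xy.
  rewrite formDr form_phi_eq0 add0r formZr rmorph_nat => /eqP.
  by rewrite scaler_eq0 (negPf n0) => /eqP.
by have := polycurve_eq0 ph h0 0; rewrite /h scale0r subr0.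
Qed.

(** Once [phi = 0], [segre_odd] has zero right-hand side; dividing [F z] by a
scale factor of [z] and letting this factor tend to [0] in the arguments of [f]
leaves twice [F z (f y (cmx w))] on the left. *)
Lemma phi_eq0_fields : (forall w, phi w = 0) ->
  (forall z w, f z w = 0) /\ (forall z w, g z w = 0).
Proof.
move=> p0; split=> z w; last by rewrite g_phi p0 form0r scaler0.
apply: (nondeg_form herm nondeg) => y.
pose x := (2 * 'i) *: F z y.
pose h t := F (f z (w + t *: x) + f z (w + t *: - x)) y.
have ph : polycurve h.
  apply: polycurve_form; last exact: polycurve_cst.
  by apply: polycurveD; apply: f_poly; [exact: polycurve_cst|exact: polycurve_line
    |exact: polycurve_cst|exact: polycurve_line].
have h0 n : h n.+1%:R = 0.
  have n0 : n.+1%:R != 0 :> C by rewrite pnatr_eq0.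
  have := segre_odd (n.+1%:R *: y) z (cmx w).
  rewrite !p0 cmxK !form0r !form0l mul0rn subrr addr0 formZr rmorph_nat.
  rewrite scalerA [_ * n.+1%:R]mulrC -scalerA -/x formZl => /eqP.
  rewrite scaler_eq0 (negPf n0) /= => /eqP yh.
  by rewrite /h scalerN (formC herm) yh cmx0.
have := polycurve_eq0 ph h0 0; rewrite /h !scale0r addr0 formDl -mulr2n => /eqP.
by rewrite -scaler_nat scaler_eq0 pnatr_eq0 => /eqP.
Qed.
End CRfield.

(** * The generic rank in codimension at most three *)

Section GenericRank.
Variable C : numClosedFieldType.
Variables (m k : nat) (A : 'I_k -> 'M[C]_m).
Hypothesis herm : forall j, adjmx (A j) = A j.
Hypothesis indep : forall c, pencil A c = 0 -> c = 0.
Hypothesis nondeg : forall x, (forall z, form A z x = 0) -> x = 0.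
Local Notation P := (pencil A).
Local Notation M := (evmx A).
Local Notation F := (form A).

Lemma rank_ge1 : (0 < k)%N -> exists a, (0 < \rank (M a))%N.
Proof.
case: (k) A indep => // n A' indep' _; apply: contrapT => h.
pose d : 'cV[C]_n.+1 := delta_mx 0 0.
have : d = 0.
  apply: indep'; apply: dot_quad_eq0 => b.
  suff : evmx A' b = 0 by rewrite -evmx_mul => ->; rewrite mul0mx dot0l.
  apply: contrapT => /eqP h'; apply: h; exists b; by rewrite lt0n mxrank_eq0.
by move/matrixP/(_ 0 0); rewrite !mxE eqxx => /eqP; rewrite oner_eq0.
Qed.

(** The combination [A_0 + i A_1] is not proportional to its adjoint. *)
Lemma rank_ge2 : (1 < k)%N -> exists a, (1 < \rank (M a))%N.
Proof.
move=> k1; pose i0 := Ordinal (ltnW k1); pose i1 := Ordinal k1.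
pose c : 'cV[C]_k := 'i *: delta_mx i1 0 + delta_mx i0 0.
have [t|b [r1 [r2 min_b]]] := @pencil_conj_indep _ _ _ A herm indep c.
  apply/eqP => ct; have /matrixP/(_ i0 0) := ct; have /matrixP/(_ i1 0) := ct.
  rewrite !mxE !eqxx /= !mulr1 !mulr0 add0r addr0 rmorph1 conjCi => h1 h2.
  have /eqP : - 'i = 'i :> C by rewrite h1 -[t]mulr1 -h2 mul1r.
  by rewrite eq_sym -addr_eq0 -mulr2n -mulr_natl mulf_eq0 pnatr_eq0 (negPf (neq0Ci _)).
exists b; rewrite ltnNge; apply: contraNN min_b => rb.
by rewrite -!evmx_mul; apply/eqP/minor2_rank.
Qed.

(** A minor of maximal size stands for the set of generic points: where it does
not vanish the rank of [M(a)] is maximal, that is [k], or 2 with [k = 3]. *)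
Lemma generic_minor : (k <= 3)%N ->
  exists r (L : 'M[C]_(r, m)) (N : 'M[C]_(k, r)),
  [/\ exists a, \det (L *m M a *m N) != 0, (k <= r.+1)%N &
      forall a, \det (L *m M a *m N) != 0 -> forall x, T_orth A a x -> x = 0].
Proof.
move=> k3.
have [[a ra]|small] := pselect (exists a, \rank (M a) = k).
  have [L [N LN]] := rank_sandwich (M a).
  exists (\rank (M a)), L, N; split; last 1 first.
  - move=> b /det_sandwich_rank; rewrite ra => rb x.
    apply: (T_orth_full herm nondeg); apply/eqP; rewrite eqn_leq rb andbT.
    exact: rank_leq_col.
  - by exists a; rewrite LN det1 oner_neq0.
  - by rewrite ra leqnSn.
have rlt a : (\rank (M a) < k)%N.
  rewrite ltn_neqAle rank_leq_col andbT; apply/eqP => ra; apply: small.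
  by exists a.
have k1 : (1 < k)%N.
  have k0 : (0 < k)%N by apply: leq_ltn_trans (rlt 0).
  by have [a ra] := rank_ge1 k0; apply: leq_ltn_trans (rlt a).
have [a ra] := rank_ge2 k1.
have keq : k = 3%N.
  by apply/eqP; rewrite eqn_leq k3; apply: leq_ltn_trans (rlt a).
have le2 b : (\rank (M b) < 3)%N by rewrite -keq.
have ra2 : \rank (M a) = 2%N by apply/eqP; rewrite eqn_leq ra andbT -ltnS le2.
have [L [N LN]] := rank_sandwich (M a).
exists (\rank (M a)), L, N; split; last 1 first.
- move=> b /det_sandwich_rank; rewrite ra2 => rb x.
  have rb2 : (\rank (M b)).+1 = k.
    transitivity 3%N => //; apply/eqP; rewrite eqSS eqn_leq rb andbT -ltnS.
    exact: le2.
  have [d d0 [Md ker]] := ker_line rb2.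
  by apply: (T_orth_hyperplane herm indep nondeg _ le2 rb Md ker); rewrite keq.
- by exists a; rewrite LN det1 oner_neq0.
- by rewrite ra2 keq.
Qed.

Lemma polyfun_minor r (L : 'M[C]_(r, m)) (N : 'M[C]_(k, r)) (z : C -> 'cV[C]_m) :
  polycurve z -> polyfun (fun t => \det (L *m M (z t) *m N)).
Proof.
move=> pz; apply: polyfun_det => i j.
apply: (@polyfun_ext _ (fun t => \sum_l (\sum_s L i s * (A l *m z t) s 0) * N l j)).
  move=> t; rewrite mxE; apply: eq_bigr => l _; congr (_ * _).
  by rewrite mxE; apply: eq_bigr => s _; rewrite [M _ _ _]mxE.
apply: polyfun_sum => l; apply: polyfunM; last exact: polyfun_cst.
apply: polyfun_sum => s; apply: polyfunM; first exact: polyfun_cst.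
exact: polycurve_mulmx.
Qed.

(** Sesquilinear functions behave like polynomials without zero divisors, since
any two points lie on a common curve. *)
Lemma dot_mul_eq0 c e : (forall z y, dot (P c *m z) y * dot (P e *m z) y = 0) ->
  c = 0 \/ e = 0.
Proof.
move=> ce.
have nz c' : c' <> 0 -> exists z y, dot (P c' *m z) y <> 0.
  move=> c0; apply: contrapT => h; apply/c0/indep/dot_quad_eq0 => b.
  by apply: contrapT => h'; apply: h; exists b, b.
apply: contrapT => /not_orP[/nz[z0 [y0 h0]] /nz[z1 [y1 h1]]].
pose zt t := z0 + t *: (z1 - z0); pose yt t := y0 + t *: (y1 - y0).
have pz := polycurve_line z0 (z1 - z0); have py := polycurve_line y0 (y1 - y0).
have pf e' := polyfun_dot (polycurve_mulmx (P e') pz) py.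
have [|/(_ 0)|/(_ 1)] := polyfun_mul_eq0 (pf c) (pf e); first by move=> n; exact: ce.
  by rewrite rmorph0 !scale0r !addr0.
by rewrite rmorph1 !scale1r !subrKC.
Qed.

(** If the values [F a y] fill the hyperplane [d s = 0], a quadratic form vanishing
on it is the product of [d] with a linear form [mu], and [dot_mul_eq0] applies
to these two. *)
Lemma quadratic_form_eq0 a (B : 'M[C]_k) : (k <= (\rank (M a)).+1)%N ->
  (forall z y, ((F z y)^T *m B *m F z y) 0 0 = 0) ->
  forall s : 'cV_k, (s^T *m B *m s) 0 0 = 0.
Proof.
move=> ra q0.
pose bil (s t : 'cV[C]_k) := (s^T *m B *m t) 0 0.
have bilDl s s' t : bil (s + s') t = bil s t + bil s' t.
  by rewrite /bil linearD /= !mulmxDl mxE.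
have bilDr s s' t : bil t (s + s') = bil t s + bil t s'.
  by rewrite /bil mulmxDr mxE.
have bilZl x s t : bil (x *: s) t = x * bil s t.
  by rewrite /bil linearZ /= -!scalemxAl mxE.
have bilZr x s t : bil t (x *: s) = x * bil t s.
  by rewrite /bil -scalemxAr mxE.
change (forall s, bil s s = 0).
have [rk|rk] := eqVneq (\rank (M a)) k.
  move=> s; have [c Mc|y ->] := @form_image _ _ _ A herm a s; last exact: q0.
  have free : row_free (M a)^T by rewrite /row_free mxrank_tr rk.
  suff -> : c = 0 by apply: big1 => j _; rewrite mxE mul0r.
  apply: trmx_inj; apply: (row_free_inj free).
  by rewrite -trmx_mul Mc trmx0 linear0 mul0mx.
have {ra}rk : (\rank (M a)).+1 = k.
  by apply/eqP; rewrite eqn_leq ra andbT ltn_neqAle rk rank_leq_col.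
have [d d0 [Md ker]] := ker_line rk.
pose al (c s : 'cV[C]_k) := \sum_j c j 0 * s j 0.
have dd : dot d d != 0 by apply: contra_neq d0; exact: dot_self_eq0.
have alE c s : al c s = (c^T *m s) 0 0.
  by rewrite mxE; apply: eq_bigr => j _; rewrite mxE.
have [e ale] : exists e, al d e = 1.
  exists ((dot d d)^-1 *: cmx d); rewrite -[RHS](mulVf dd) mulr_sumr; apply: eq_bigr => j _.
  by rewrite !mxE mulrCA.
pose mu := (B *m e) + (e^T *m B)^T - bil e e *: d.
have muE s : al mu s = bil s e + bil e s - bil e e * al d s.
  have -> : al mu s = (((B *m e)^T *m s) + e^T *m B *m s - bil e e *: (d^T *m s)) 0 0.
    rewrite alE /mu linearB linearD /= [(bil e e *: d)^T]linearZ /= trmxK !mulmxDl mulNmx.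
    by rewrite -scalemxAl.
  have -> : bil s e = ((B *m e)^T *m s) 0 0.
    suff -> : (B *m e)^T *m s = (s^T *m B *m e)^T by rewrite [RHS]mxE.
    by rewrite -mulmxA [RHS]trmx_mul trmxK.
  by rewrite /bil alE !mxE.
(* [s'] is the component of [s] in the hyperplane, along [e] *)
have qE s : bil s s = al d s * al mu s.
  pose s' := s - al d s *: e.
  have [c /ker[t ->]|y s'E] := @form_image _ _ _ A herm a s'.
    have als' : al d s' = 0.
      have -> : al d s' = al d s - al d s * al d e.
        transitivity ((d^T *m s) 0 0 - al d s * (d^T *m e) 0 0).
          by rewrite [LHS]alE mulmxBr -scalemxAr !mxE.
        by rewrite -!alE.
      by rewrite ale mulr1 subrr.
    change (al (t *: d) s' = 0).
    by rewrite alE linearZ /= -scalemxAl mxE -alE als' mulr0.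
  have : bil s' s' = 0 by rewrite s'E; exact: q0.
  rewrite /s' -scaleNr bilDl !bilDr !bilZl !bilZr muE => h.
  by rewrite -[LHS]subr0 -h; ring.
have [|dz|muz] := @dot_mul_eq0 d mu.
- by move=> z y; rewrite !dot_pencil -[LHS]qE; exact: q0.
- by rewrite dz eqxx in d0.
by move=> s; rewrite qE muz /al [X in _ * X]big1 ?mulr0 // => j _; rewrite mxE mul0r.
Qed.

End GenericRank.

Section Main.
Variable C : numClosedFieldType.
Variables (m k : nat) (A : 'I_k -> 'M[C]_m).
Hypothesis herm : forall j, adjmx (A j) = A j.
Hypothesis indep : forall c, pencil A c = 0 -> c = 0.
Hypothesis nondeg : forall x, (forall z, form A z x = 0) -> x = 0.
Local Notation F := (form A).

Variables (f : 'cV[C]_m -> 'cV[C]_k -> 'cV[C]_m).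
Variables (g : 'cV[C]_m -> 'cV[C]_k -> 'cV[C]_k).
Hypothesis f_poly : forall z w, polycurve z -> polycurve w ->
  polycurve (fun t => f (z t) (w t)).
Hypothesis g_poly : forall z w, polycurve z -> polycurve w ->
  polycurve (fun t => g (z t) (w t)).
Hypothesis f_hom : forall t z w, f (t *: z) (t ^+ 2 *: w) = t ^+ 4 *: f z w.
Hypothesis g_hom : forall t z w, g (t *: z) (t ^+ 2 *: w) = t ^+ 5 *: g z w.
Hypothesis f_quad : forall i, exists B : 'M_k,
  forall w, f 0 w i 0 = (w^T *m B *m w) 0 0.
Hypothesis tangent : forall z u, cmx u = u ->
  let w := u + 'i *: F z z in
  let h := g z w - (2 * 'i) *: F (f z w) z in cmx h = h.

(** [phi_diag_eq0] applies at generic points only; multiplying by the minor [P] makes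
its conclusion hold everywhere, so that it can be polarised, and the factor [P]
is removed afterwards along a line through [a0]. *)
Lemma fields_eq0 : (k <= 3)%N ->
  (forall z w, f z w = 0) /\ (forall z w, g z w = 0).
Proof.
move=> k3; apply: (phi_eq0_fields herm nondeg f_poly g_poly f_hom g_hom tangent).
have [r [L [N [[a0 Pa0] kr T0]]]] := generic_minor herm indep nondeg k3.
pose P a := \det (L *m evmx A a *m N).
have pP z : polycurve z -> polyfun (fun t => P (z t)) by exact: polyfun_minor.
have diag a : P a *: f 0 (F a a) = 0.
  have [->|Pa] := eqVneq (P a) 0; first by rewrite scale0r.
  have := phi_diag_eq0 herm f_poly g_poly f_hom g_hom tangent (T0 a Pa).
  by move=> ->; rewrite scaler0.
have off z y : P z *: f 0 (F z y) = 0.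
  have [z0 [z1 [zE yE _]]] := polarize z y.
  pose zt t := z0 + t *: z1.
  have pz : polycurve zt by exact: polycurve_line.
  have ph : polycurve (fun t => P (zt t) *: f 0 (F (zt t) (zt t^*))).
    apply: polycurveZ; first exact: pP.
    by apply: f_poly; [exact: polycurve_cst|exact: polycurve_form].
  have := polycurve_eq0 ph _ 'i; rewrite conjCi /zt scaleNr -zE -yE; apply=> n.
  by rewrite rmorph_nat diag.
have image z y i : f 0 (F z y) i 0 = 0.
  pose zt t := a0 + t *: (z - a0).
  have pz : polycurve zt by exact: polycurve_line.
  have pf : polyfun (fun t => f 0 (F (zt t) y) i 0).
    apply: (f_poly (polycurve_cst 0) (w := fun t => F (zt t) y)).
    exact: (polycurve_form _ pz (polycurve_cst y)).
  have [n||/(_ 1)] := polyfun_mul_eq0 (pP _ pz) pf.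
  - by have /matrixP/(_ i 0) := off (zt n.+1%:R) y; rewrite !mxE.
  - by move=> /(_ 0); rewrite /zt scale0r addr0 => /eqP; rewrite (negPf Pa0).
  by rewrite /zt scale1r subrKC.
move=> w; apply/matrixP=> i j; rewrite ord1 [RHS]mxE.
have [B fB] := f_quad i; rewrite fB.
apply: (@quadratic_form_eq0 _ _ _ A herm indep a0) => [|z y].
  by apply: leq_trans kr _; rewrite ltnS; exact: det_sandwich_rank Pa0.
by rewrite -fB image.
Qed.
End Main.

Local Open Scope classical_set_scope.
Local Open Scope ring_scope.
Local Open Scope complex_scope.

(** * Weighted homogeneous polynomials *)

Section Weighted.
Variables (R : realType) (m k : nat).
Local Notation C := R[i].

Lemma meval_split (p : mpoly (m + k) C) (z : 'cV[C]_m) (w : 'cV[C]_k) :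
  meval (fun i => col_mx z w i 0) p =
  \sum_(mu <- msupp p) mcoeff mu p *
    ((\prod_i z i 0 ^+ mu (lshift k i)) * (\prod_j w j 0 ^+ mu (rshift m j))).
Proof.
rewrite mevalE; apply: eq_bigr => mu _; congr (_ * _).
rewrite big_split_ord; congr (_ * _); apply: eq_bigr => i _.
  by rewrite col_mxEu.
by rewrite col_mxEd.
Qed.

Lemma meval_whomog (d : nat) (p : mpoly (m + k) C) t
    (z : 'cV_m) (w : 'cV_k) : @whomog R m k d%:Z p ->
  meval (fun i => col_mx (t *: z) (t ^+ 2 *: w) i 0) p =
  t ^+ d * meval (fun i => col_mx z w i 0) p.
Proof.
move=> hp; rewrite !meval_split mulr_sumr; apply: eq_big_seq => mu /hp[<-].
rewrite [RHS]mulrCA; congr (_ * _).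
rewrite /wdeg exprD exprM mulrACA; congr (_ * _).
  by rewrite -prodrXr -big_split; apply: eq_bigr => i _; rewrite mxE exprMn.
by rewrite -prodrXr -big_split; apply: eq_bigr => i _; rewrite mxE exprMn.
Qed.

(** At [z = 0] only the monomials free of [z] remain, and weight 4 makes these
quadratic in [w]. *)
Lemma whomog4_quadratic (p : mpoly (m + k) C) : @whomog R m k 4%:Z p ->
  exists B : 'M[C]_k, forall w : 'cV_k,
    meval (fun i => col_mx 0 w i 0) p = (w^T *m B *m w) 0 0.
Proof.
move=> hp; have /choice[B Bmu] (mu : multinom (m + k)) : exists B : 'M[C]_k,
    mu \in msupp p -> forall w : 'cV_k, (\prod_i (0 : 'cV[C]_m) i 0 ^+ mu (lshift k i))
      * (\prod_j w j 0 ^+ mu (rshift m j)) = (w^T *m B *m w) 0 0.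
  have [[i mui]|mu0] := pselect (exists i, mu (lshift k i) != 0%N).
    exists 0 => _ w; rewrite mulmx0 mul0mx [RHS]mxE (bigD1 i) //= mxE.
    by rewrite expr0n (negPf mui) !mul0r.
  have {}mu0 i : mu (lshift k i) = 0%N.
    by apply/eqP; apply: contraT => h; case: mu0; exists i.
  have [mu_p|] := boolP (mu \in msupp p); last by exists 0.
  have [l [j lj]] : exists l j, forall w : 'I_k -> C,
      \prod_s w s ^+ mu (rshift m s) = w l * w j.
    apply: quadratic_monomial; have [] := hp mu mu_p.
    by rewrite /wdeg big1 // add0n => /eqP; rewrite -[4%N]/(2 * 2)%N eqn_pmul2l // => /eqP.
  exists (delta_mx l (0 : 'I_1) *m delta_mx 0 j) => _ w.
  rewrite big1 ?mul1r => [|i _]; last by rewrite mu0.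
  by rewrite lj mulmxA -colE -mulmxA -rowE mxE big_ord1 !mxE.
exists (\sum_(mu <- msupp p) mcoeff mu p *: B mu) => w.
rewrite meval_split mulmx_sumr mulmx_suml summxE; apply: eq_big_seq => mu mu_p.
by rewrite Bmu // -scalemxAr -scalemxAl [RHS]mxE.
Qed.
End Weighted.

(** * Generic sets *)

Section Topology.
Variables (R : realType).
Local Notation C := R[i].

Section Continuity.
Variable T : topologicalType.

Lemma continuous_sumr I (s : seq I) (h : I -> T -> C^o) :
  (forall i, continuous (h i)) -> continuous (fun a => \sum_(i <- s) h i a : C^o).
Proof.
by move=> ch; apply: (@continuous_big C^o I +%R 0 xpredT _ T) => [|i _];
  [exact: add_continuous|exact: ch].
Qed.

Lemma continuous_prodr I (s : seq I) (h : I -> T -> C^o) :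
  (forall i, continuous (h i)) -> continuous (fun a => \prod_(i <- s) h i a : C^o).
Proof.
by move=> ch; apply: (@continuous_big C^o I *%R 1 xpredT _ T) => [|i _];
  [exact: mul_continuous|exact: ch].
Qed.

Lemma continuous_cstMr c (h : T -> C^o) :
  continuous h -> continuous (fun a => c * h a : C^o).
Proof. by move=> ch a; apply: (@continuousM C); [exact: cst_continuous|exact: ch]. Qed.

Lemma continuous_detr n (M : T -> 'M[C^o]_n) :
  (forall i j, continuous (fun a => M a i j : C^o)) ->
  continuous (fun a => \det (M a) : C^o).
Proof.
move=> cM; apply: continuous_sumr => s; apply: continuous_cstMr.
by apply: continuous_prodr => i; exact: cM.
Qed.
End Continuity.

Variables (m k : nat) (A : 'I_k -> 'M[C]_m).

Lemma continuous_minor r (L : 'M[C]_(r, m)) (N : 'M[C]_(k, r)) :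
  continuous (fun a : 'cV[C^o]_m => \det (L *m evmx A a *m N) : C^o).
Proof.
apply: continuous_detr => i j.
have -> : (fun a : 'cV[C^o]_m => (L *m evmx A a *m N) i j : C^o) =
    (fun a => \sum_l \sum_s \sum_u (L i s * A l s u * N l j) * a u 0).
  apply/funext => a; rewrite mxE; apply: eq_bigr => l _.
  rewrite mxE mulr_suml; apply: eq_bigr => s _.
  rewrite [evmx _ _ _ _]mxE mxE mulr_sumr mulr_suml; apply: eq_bigr => u _.
  ring.
apply: continuous_sumr => l; apply: continuous_sumr => s.
apply: continuous_sumr => u; apply: continuous_cstMr.
exact: (@coord_continuous C m 1 u 0).
Qed.

(** Density: on a line from [a] to a point where [h] does not vanish, [h] has
finitely many zeros, while the ball around [a] contains the points
[a + (s / n.+1) b] for all [n]. *)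
Lemma generic_nonzero (h : 'cV[C]_m -> C) (P : 'cV[C]_m -> Prop) :
  continuous (h : 'cV[C^o]_m -> C^o) ->
  (forall z, polycurve z -> polyfun (fun t => h (z t))) ->
  (exists a, h a != 0) -> (forall a, h a != 0 -> P a) -> generic P.
Proof.
move=> ch ph [a0 ha0] hP; exists [set a | h a != 0]; split => //.
- apply: (@open_comp _ _ (h : 'cV[C^o]_m -> C^o) [set x | x != 0]).
    by move=> x _; exact: ch.
  rewrite (_ : [set x | x != 0] = ~` [set (0 : C^o)]).
    apply: closed_openC; apply: accessible_closed_set1.
    by apply: hausdorff_accessible; exact: norm_hausdorff.
  by apply/seteqP; split=> x /= /eqP.
move=> O [a Oa] oO.
have : nbhs (a : 'cV[C^o]_m) O by exact: open_nbhs_nbhs.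
move=> /nbhs_ballP[e /= e0 aeO].
have [b bE] : exists b : 'cV[C]_m, b = a0 - a by exists (a0 - a).
have [s s0 sb] : exists2 s : C, 0 < s & forall i, s * `|b i 0| < e.
  have sum0 : 0 < 1 + \sum_i `|b i 0| :> C by rewrite ltr_pwDl ?ltr01 ?sumr_ge0.
  exists (e / (1 + \sum_i `|b i 0|)) => [|i]; first by rewrite divr_gt0.
  rewrite mulrAC ltr_pdivrMr // ltr_pM2l // (bigD1 i) //= addrCA.
  by rewrite ltrDl ltr_pwDl ?ltr01 ?sumr_ge0.
have near n : O (a + (s / n.+1%:R) *: b).
  apply: aeO; split=> // i j; rewrite ord1 -ball_normE /= !mxE opprD addNKr normrN.
  rewrite normrM ger0_norm ?divr_ge0 ?ler0n ?(ltW s0) //.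
  apply: le_lt_trans (sb i); rewrite ler_wpM2r // ler_pdivrMr ?ltr0n //.
  by rewrite ler_peMr ?(ltW s0) // ler1n.
have [p hp] := ph _ (polycurve_line (a : 'cV[C]_m) b).
suff [n hn] : exists n, h (a + (s / n.+1%:R) *: b) != 0.
  by exists (a + (s / n.+1%:R) *: b); split => //; exact: near.
apply: contrapT => no; move/eqP: ha0; apply.
have -> : a0 = a + 1 *: b by rewrite scale1r bE subrKC.
rewrite hp (@poly_eq0_inj _ p (fun n => s / n.+1%:R)) ?horner0 //.
  move=> i j /(mulfI (lt0r_neq0 s0))/invr_inj/eqP.
  by rewrite eqr_nat => /eqP[].
move=> n; rewrite -hp; apply: contrapT => /eqP hn; apply: no; by exists n.
Qed.
End Topology.

(** * Polynomial vector fields and the theorem *)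

Section Bridge.
Variables (R : realType) (m k : nat) (A : 'I_k -> 'M[R[i]]_m).
Local Notation C := R[i].

Lemma free_pencil : free [seq A j | j : 'I_k] -> forall c, pencil A c = 0 -> c = 0.
Proof.
have -> : [seq A j | j : 'I_k] = [tuple A j | j < k] by [].
move=> /freeP fA c c0; apply/matrixP=> j l; rewrite ord1 mxE.
apply: (fA (fun j => c j 0)); rewrite -[RHS]c0; apply: eq_bigr => i _.
by rewrite (nth_map i) ?size_enum_ord // nth_ord_enum.
Qed.

Lemma hermsymmx_adj (B : 'M[C]_m) : B \is hermsymmx -> adjmx B = B.
Proof. by rewrite qualifE /= expr0 scale1r => /eqP {2}->. Qed.

Lemma polycurve_eval n (p : 'cV[mpoly (m + k) C]_n) (z : C -> 'cV[C]_m) (w : C -> 'cV[C]_k) :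
  polycurve z -> polycurve w -> polycurve (fun t => eval_zw (z t) (w t) p).
Proof.
move=> pz pw i; apply: (@polyfun_ext _ (fun t =>
    meval (fun l => col_mx (z t) (w t) l 0) (p i 0))).
  by move=> t; rewrite mxE.
apply: polyfun_meval => l; case: (split_ordP l) => s ->.
  by apply: polyfun_ext (pz s) => t; rewrite col_mxEu.
by apply: polyfun_ext (pw s) => t; rewrite col_mxEd.
Qed.

Lemma eval_zw_eq0 n (p : 'cV[mpoly (m + k) C]_n) :
  (forall z w, eval_zw z w p = 0) -> p = 0.
Proof.
move=> p0; apply/matrixP=> i j; rewrite ord1 mxE; apply: meval_eq0 => v.
pose x : 'cV[C]_(m + k) := \col_l v l.
have /matrixP/(_ i 0) := p0 (usubmx x) (dsubmx x); rewrite !mxE => <-.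
by apply: meval_eq => l; rewrite vsubmxK mxE.
Qed.

Lemma Im_eq0_conj (x : C) : complex.Im x = 0 -> x^*%R = x.
Proof. by case: x => a b /= ->; rewrite -[LHS]/(a -i* 0) oppr0. Qed.

Lemma conj_fix_real (x : C) : x^*%R = x -> x = (complex.Re x)%:C.
Proof.
case: x => a b [/eqP]; rewrite -subr_eq0 -opprD oppr_eq0 -mulr2n mulrn_eq0 /=.
by move=> /eqP ->.
Qed.

End Bridge.

Theorem proposition7p1 (R : realType) (m k : nat) (A : 'I_k -> 'M[R[i]]_m)
    (hA : forall j : 'I_k, A j \is hermsymmx)
    (hF : nondegenerate_form A) (hk : (k <= 3)%N) :
  T_nondegenerate_form A /\ gcomp A 3 = [set 0].
Proof.
have herm j : adjmx (A j) = A j by exact: hermsymmx_adj.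
have indep := free_pencil hF.1.
have nondeg : forall x, (forall z, form A z x = 0) -> x = 0 := hF.2.
split.
  split=> //.
  have [r [L [N [nz _ T0]]]] := generic_minor herm indep nondeg hk.
  apply: (@generic_nonzero _ _ (fun a => \det (L *m evmx A a *m N))) => //.
  - exact: continuous_minor.
  - by move=> z; exact: polyfun_minor.
  move=> a /T0 Ta; apply/seteqP; split=> x; first exact: Ta.
  by move=> /= -> y _; exact: form0l.
apply/seteqP; split=> [[f g] [/= hf hg tangent]|_ ->]; last first.
  have e0 n (z : 'cV_m) (w : 'cV_k) :
      eval_zw z w (0 : 'cV[mpoly (m + k) R[i]]_n) = 0.
    by apply/matrixP=> i j; rewrite !mxE meval0.
  split=> [i mu|i mu|z u] /=; rewrite ?mxE ?msupp0 //.
  rewrite /= !e0 (form0l A z : hform A 0 z = 0) scaler0 subr0.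
  by apply/matrixP=> i j; rewrite !mxE.
have [||||||f0 g0] := @fields_eq0 _ _ _ A herm indep nondeg
   (fun z w => eval_zw z w f) (fun z w => eval_zw z w g) _ _ _ _ _ _ hk.
- by move=> z w; exact: polycurve_eval.
- by move=> z w; exact: polycurve_eval.
- move=> t z w; apply/matrixP=> i j; rewrite ord1 !mxE.
  by apply: (@meval_whomog _ _ _ 4) => //; exact: hf.
- move=> t z w; apply/matrixP=> i j; rewrite ord1 !mxE.
  by apply: (@meval_whomog _ _ _ 5) => //; exact: hg.
- move=> i; have [B fB] := whomog4_quadratic (hf i).
  by exists B => w; rewrite mxE fB.
- move=> z u ur w h; have uE : u = map_mx (real_complex R) (map_mx (@complex.Re R) u).
    apply/matrixP=> i j; rewrite !mxE; apply: conj_fix_real.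
    by have /matrixP/(_ i j) := ur; rewrite mxE.
  apply/matrixP=> i j; rewrite mxE; apply: Im_eq0_conj.
  have /matrixP/(_ i j) := tangent z (map_mx (@complex.Re R) u).
  by rewrite -uE mxE => ->; rewrite mxE.
by congr (_, _); exact: eval_zw_eq0.
Qed.
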